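(* Let $A$ be a real $3\times 3$ symmetric matrix with entries $a_{ij}$, $i,j=1,2,3$. With $I$ the $3\times 3$ identity matrix, let $$q=\mathrm{tr}(A)/3=(a_{11}+a_{22}+a_{33})/3,$$ $$p=\big(\mathrm{tr}((A-qI)^2)/6\big)^{1/2}=\Big(\big((a_{11}-q)^2+(a_{22}-q)^2+(a_{33}-q)^2+2a_{12}^2+2a_{13}^2+2a_{23}^2\big)/6\Big)^{1/2}.$$ If $p=0$, then $A=\mathrm{diag}\{q,q,q\}$, and letting $\alpha_k=q$, $k=1,2,3$, the numbers $\alpha_k$, $k=1,2,3$, are the eigenvalues (the same eigenvalue) of $A$. Otherwise, let $B=(A-qI)/p$, and let $\theta_3=\arccos(\det(B)/2)/3$, $\theta_2=2\pi/3-\theta_3$, $\theta_1=2\pi/3+\theta_3$. Let $\alpha_k=2p\cos\theta_k+q$, $k=1,2,3$. Then $\alpha_1\leq\alpha_2\leq\alpha_3$, and $\alpha_k$, $k=1,2,3$, are the eigenvalues of $A$.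
   Context: Eigenvalues are listed with multiplicity. $\mathrm{diag}\{s_1,s_2,s_3\}$ is the diagonal matrix with diagonal entries $s_1,s_2,s_3$ in that order. $\arccos$ takes values in $[0,\pi]$; part of the assertion is that $\arccos(\det(B)/2)$ is well defined, i.e. $|\det(B)|\leq 2$. *)

(* Defs.v *)
From HB Require Import structures.
From mathcomp Require Import all_boot all_order all_algebra.
From mathcomp Require Import all_classical all_reals all_analysis.

Set Implicit Arguments.
Unset Strict Implicit.
Unset Printing Implicit Defensive.

Import Order.TTheory GRing.Theory Num.Theory.
Local Open Scope ring_scope.

(* Multiplicity is algebraic: s lists the roots of the characteristic
   polynomial, each repeated according to its multiplicity as a root.  In
   particular size s = n and A has no eigenvalue, even in an extension of F,
   outside s.  The order of s is irrelevant. *)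
Definition eigenvalues_with_mult (F : fieldType) (n : nat) (A : 'M[F]_n)
    (s : seq F) : Prop :=
  char_poly A = \prod_(a <- s) ('X - a%:P).

(* Main.v *)
Require Import Defs.
From HB Require Import structures.
From mathcomp Require Import all_boot all_order all_algebra.
From mathcomp Require Import all_classical all_reals all_analysis.
From mathcomp Require Import ring lra.

Set Implicit Arguments.
Unset Strict Implicit.
Unset Printing Implicit Defensive.

Import Order.TTheory GRing.Theory Num.Theory.
Local Open Scope ring_scope.

(** Shifting by [q] makes [A] traceless and dividing by [p] normalises
    [\tr (B *m B)] to 6, so that [B] has characteristic polynomial
    [X^3 - 3 X - \det B] ([char_poly_normalized]).  The substitution
    [X = 2 cos t] turns [X^3 - 3 X] into [2 cos (3 t)], by the triple angle
    formula; with [2 cos (3 t) = \det B] the three roots are therefore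
    [2 cos t] and [2 cos (2 pi / 3 +- t)] ([cubic_cos_factor]).  They are
    carried back to [A = p B + q] by [eigenvalues_affine].

    The angle [t = acos (\det B / 2) / 3] is available because
    [`|\det B| <= 2] ([normr_det_normalized_le2]); this is where symmetry is
    essential.  It does not require the spectral theorem: the matrix
    [C = B^2 - (d / 2) B - 2 I], with [d = \det B], is symmetric, so
    [\tr (C^2)] is a sum of squares, while Cayley-Hamilton evaluates this
    trace as [6 - 3 d^2 / 2].  Up to a positive factor, that number is the
    discriminant of the characteristic polynomial.

    Finally [t] lies in [[0, pi / 3]], hence
    [0 <= t <= 2 pi / 3 - t <= 2 pi / 3 + t <= pi], and the ordering follows
    because [cos] decreases on [[0, pi]]. *)

(** * The characteristic polynomial of a 3 x 3 matrix *)

Lemma sum_ord3 (V : nmodType) (F : 'I_3 -> V) :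
  \sum_i F i = F 0 + F 1 + F 2.
Proof.
by rewrite !big_ord_recl big_ord0 addr0 addrA; congr (_ + F _ + F _);
  exact/val_inj.
Qed.

Lemma mxtrace3 (R : comNzRingType) (M : 'M[R]_3) :
  \tr M = M 0 0 + M 1 1 + M 2 2.
Proof. exact: sum_ord3. Qed.

Lemma det_mx22 (R : comNzRingType) (N : 'M[R]_2) :
  \det N = N 0 0 * N 1 1 - N 0 1 * N 1 0.
Proof.
rewrite (expand_det_row _ 0) !big_ord_recl big_ord0 /cofactor !det_mx11 !mxE.
rewrite (_ : lift 0 0 = 1 :> 'I_2) /=; last exact/val_inj.
rewrite (_ : lift 1 0 = 0 :> 'I_2) /=; last exact/val_inj.
by rewrite expr0 expr1; ring.
Qed.

Lemma det_mx33 (R : comNzRingType) (M : 'M[R]_3) :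
  \det M = M 0 0 * (M 1 1 * M 2 2 - M 1 2 * M 2 1)
         - M 0 1 * (M 1 0 * M 2 2 - M 1 2 * M 2 0)
         + M 0 2 * (M 1 0 * M 2 1 - M 1 1 * M 2 0).
Proof.
rewrite (expand_det_row _ 0) sum_ord3 /cofactor.
have liftE :
    (lift 0 (0 : 'I_2) = 1 :> 'I_3) * (lift 0 (1 : 'I_2) = 2 :> 'I_3) *
    (lift 1 (0 : 'I_2) = 0 :> 'I_3) * (lift 1 (1 : 'I_2) = 2 :> 'I_3) *
    (lift 2 (0 : 'I_2) = 0 :> 'I_3) * (lift 2 (1 : 'I_2) = 1 :> 'I_3).
  by do !split; apply/val_inj.
by rewrite !det_mx22 !mxE !liftE /= expr0 expr1 sqrrN expr1n; ring.
Qed.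

Definition sum_principal_minors2 (R : comNzRingType) (M : 'M[R]_3) : R :=
  (M 0 0 * M 1 1 - M 0 1 * M 1 0) + (M 0 0 * M 2 2 - M 0 2 * M 2 0)
  + (M 1 1 * M 2 2 - M 1 2 * M 2 1).

(** Newton's identity [2 e_2 = p_1^2 - p_2] between the second elementary
    symmetric function and the power sums of the eigenvalues. *)
Lemma sum_principal_minors2E (R : comNzRingType) (M : 'M[R]_3) :
  2 * sum_principal_minors2 M = (\tr M) ^+ 2 - \tr (M *m M).
Proof. by rewrite !mxtrace3 !mxE !sum_ord3 /sum_principal_minors2; ring. Qed.

Lemma char_poly3 (R : comNzRingType) (M : 'M[R]_3) :
  char_poly M = 'X^3 - (\tr M)%:P * 'X^2
                + (sum_principal_minors2 M)%:P * 'X - (\det M)%:P.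
Proof.
rewrite /char_poly !det_mx33 mxtrace3 /sum_principal_minors2 !mxE /=.
rewrite !rmorphD /= !rmorphM /= !rmorphB /= !rmorphM /= !mulr1n !mulr0n.
by ring.
Qed.

Lemma char_poly_normalized (R : realFieldType) (B : 'M[R]_3) :
  \tr B = 0 -> \tr (B *m B) = 6 ->
  char_poly B = 'X^3 - 3%:P * 'X - (\det B)%:P.
Proof.
move=> t1 t2; have := sum_principal_minors2E B; rewrite t1 t2 => e2.
have {}e2 : sum_principal_minors2 B = - 3 by lra.
by rewrite char_poly3 t1 e2 polyC0 mul0r subr0 polyCN mulNr.
Qed.

(** For [p != 0] the matrix ['X - (p B + q)] is [p] times the image of
    ['X - B] under the substitution [X := (X - q) / p]; taking determinants
    relates the two characteristic polynomials. *)
Lemma eigenvalues_affine (F : fieldType) (n : nat) (B : 'M[F]_n) (p q : F)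
    (s : seq F) :
  p != 0 -> eigenvalues_with_mult B s ->
  eigenvalues_with_mult (p *: B + q%:M) [seq p * a + q | a <- s].
Proof.
rewrite /eigenvalues_with_mult => p0 eB.
pose f := p^-1%:P * ('X - q%:P).
have szs : size s = n.
  by have := size_char_poly B; rewrite eB size_prod_XsubC => -[].
have pf : p%:P * f = 'X - q%:P by rewrite mulrA -polyCM divff // mul1r.
transitivity (p%:P ^+ n * (char_poly B \Po f)).
  rewrite /char_poly -det_map_mx -detZ; congr (\det _); apply/matrixP => i j.
  rewrite !mxE /= rmorphB /= comp_polyC rmorphMn /= comp_polyX mulrBr mulrnAr.
  by rewrite pf polyCD polyCM polyCMn mulrnBl; ring.
rewrite eB -szs; elim: s {eB szs} => [|a s IHs] /=.
  by rewrite !big_nil rmorph1 mulr1.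
rewrite !big_cons -IHs rmorphM rmorphB /= comp_polyX comp_polyC exprS.
have -> : 'X - (p * a + q)%:P = p%:P * (f - a%:P).
  by rewrite mulrBr pf polyCD polyCM opprD addrA addrAC.
by rewrite mulrACA.
Qed.

(** * Symmetric matrices and the bound on the determinant *)

Lemma trace_sqr_sym (R : comNzRingType) (n : nat) (S : 'M[R]_n) :
  S^T = S -> \tr (S *m S) = \sum_i \sum_j S i j ^+ 2.
Proof.
move=> symS; apply: eq_bigr => i _; rewrite mxE; apply: eq_bigr => j _.
by rewrite -[in S j i]symS mxE expr2.
Qed.

Lemma trace_sqr_sym_ge0 (R : realDomainType) (n : nat) (S : 'M[R]_n) :
  S^T = S -> 0 <= \tr (S *m S).
Proof.
move=> symS; rewrite trace_sqr_sym //.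
by do 2![apply: sumr_ge0 => ? _]; apply: sqr_ge0.
Qed.

Lemma trace_sqr_sym_eq0 (R : realDomainType) (n : nat) (S : 'M[R]_n) :
  S^T = S -> \tr (S *m S) = 0 -> S = 0.
Proof.
move=> symS; rewrite trace_sqr_sym // => /eqP; rewrite psumr_eq0; last first.
  by move=> i _; apply: sumr_ge0 => j _; apply: sqr_ge0.
move=> /allP rows0; apply/matrixP => i j; rewrite mxE.
have := rows0 i (mem_index_enum i); rewrite psumr_eq0; last first.
  by move=> k _; apply: sqr_ge0.
by move=> /allP /(_ j (mem_index_enum j)); rewrite /= sqrf_eq0 => /eqP.
Qed.

(** Cayley-Hamilton reads [B^3 = 3 B + d], whence [\tr (B^3) = 3 d] and
    [\tr (B^4) = 18].  The matrix [C] below is the component of [B^2]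
    orthogonal to [I] and [B] for the trace form, which is positive on
    symmetric matrices; its squared norm [6 - 3 d^2 / 2] is thus nonnegative. *)
Lemma normr_det_normalized_le2 (R : realFieldType) (B : 'M[R]_3) :
  B^T = B -> \tr B = 0 -> \tr (B *m B) = 6 -> `|\det B| <= 2.
Proof.
move=> symB t1 t2; set d := \det B.
have cubeB : B *m B *m B = 3 *: B + d%:M.
  have := Cayley_Hamilton B; rewrite char_poly_normalized // -/d.
  rewrite !(rmorphB, rmorphM) /= !horner_mx_C horner_mx_X => /eqP.
  rewrite subr_eq add0r => /eqP <-.
  by rewrite -!mulmxE mul_scalar_mx mulmxA addrC subrK.
have t3 : \tr (B *m B *m B) = 3 * d.
  by rewrite cubeB mxtraceD mxtraceZ mxtrace_scalar t1 mulr0 add0r mulr_natl.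
have t4 : \tr (B *m B *m B *m B) = 18.
  rewrite cubeB mulmxDl -scalemxAl mul_scalar_mx mxtraceD !mxtraceZ t1 t2.
  by ring.
pose C := B *m B - (d / 2) *: B - 2%:M.
have symC : C^T = C.
  by rewrite /C !raddfB /= linearZ /= trmx_mul tr_scalar_mx symB.
have := trace_sqr_sym_ge0 symC.
have -> : \tr (C *m C) = 6 - (3 / 2) * d ^+ 2.
  rewrite /C !mulmxBl !mulmxBr -!scalemxAl -!scalemxAr.
  rewrite !mul_scalar_mx !mul_mx_scalar !mulmxA !raddfB /= !mxtraceZ.
  by rewrite mxtrace_scalar t4 t3 t2 t1; field.
by move=> ge0; rewrite -ler_sqr ?nnegrE // real_normK ?num_real //; lra.
Qed.

(** * The trigonometric solution of the normalised cubic *)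

(** With [a = pi / 3], the duplication formula and [cos (2 a) = - cos a]
    give [(2 cos a - 1) (cos a + 1) = 0], and [cos a] is positive. *)
Lemma cos_2pi3 (R : realType) : cos (2 * pi / 3) = - (1 / 2) :> R.
Proof.
have pi0 := pi_gt0 R.
set a : R := pi / 3.
have : cos (2 * pi / 3) = - cos a.
  by rewrite -cosDpi -cosN -cosD2pi; congr cos; rewrite /a; lra.
rewrite (_ : 2 * pi / 3 = a *+ 2); last by rewrite /a; lra.
rewrite cos_mulr2n => cos2a.
have cosa_gt0 : 0 < cos a.
  by apply: cos_gt0_pihalf; rewrite /a; apply/andP; split; lra.
have /eqP : (2 * cos a - 1) * (cos a + 1) = 0 by lra.
by rewrite mulf_eq0 => /orP[]/eqP; lra.
Qed.

Lemma sin_2pi3_sqr (R : realType) : sin (2 * pi / 3) ^+ 2 = 3 / 4 :> R.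
Proof. by have := cos2Dsin2 (2 * pi / 3 : R); rewrite cos_2pi3; lra. Qed.

Lemma cos_mulr3n (R : realType) (t : R) :
  cos (t *+ 3) = 4 * cos t ^+ 3 - 3 * cos t.
Proof.
have sin2 : sin t ^+ 2 = 1 - cos t ^+ 2 by have := cos2Dsin2 t; lra.
rewrite mulrS cosD cos_mulr2n sin_mulr2n.
transitivity (cos t * (cos t ^+ 2 *+ 2 - 1) - cos t * sin t ^+ 2 *+ 2).
  by ring.
by rewrite sin2; ring.
Qed.

(** Tripling [t], [2 pi / 3 - t] or [2 pi / 3 + t] gives [3 t] up to sign and
    a multiple of [2 pi], so all three cosines solve the cubic.  An equality of
    polynomials, rather than three evaluations, also yields the multiplicities
    when some of these cosines coincide. *)
Lemma cubic_cos_factor (R : realType) (t : R) :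
  'X^3 - 3%:P * 'X - (2 * cos (t *+ 3))%:P =
  ('X - (2 * cos (2 * pi / 3 + t))%:P) *
  (('X - (2 * cos (2 * pi / 3 - t))%:P) * ('X - (2 * cos t)%:P)).
Proof.
set u := 2 * pi / 3; set x := cos t; set w := sin u * sin t.
have w2 : w ^+ 2 = 3 / 4 * (1 - x ^+ 2).
  by rewrite exprMn sin_2pi3_sqr; have := cos2Dsin2 t; rewrite -/x; lra.
have cos_plus : 2 * cos (u + t) = - x - 2 * w.
  by rewrite cosD cos_2pi3 -/x -/w; lra.
have cos_minus : 2 * cos (u - t) = - x + 2 * w.
  by rewrite cosB cos_2pi3 -/x -/w; lra.
rewrite cos_plus cos_minus cos_mulr3n -/x.
(* The middle quadratic is the quotient of the cubic by its root 2 x; its own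
   roots are - x +- 2 w. *)
transitivity (('X ^+ 2 + (2 * x)%:P * 'X + (x ^+ 2 - 4 * w ^+ 2)%:P)
              * ('X - (2 * x)%:P)).
  rewrite w2 (_ : x ^+ 2 - 4 * _ = 4 * x ^+ 2 - 3); last by field.
  by rewrite !(rmorphB, rmorphM, rmorphXn, rmorph_nat) /=; ring.
rewrite mulrA; congr (_ * _).
by rewrite !(rmorphB, rmorphM, rmorphXn, rmorph_nat, rmorphD, rmorphN) /=; ring.
Qed.

(** * The eigenvalues of a symmetric 3 x 3 matrix *)

Theorem theorem3 (R : realType) (A : 'M[R]_3) (hA : A^T = A) :
  let q := \tr A / 3 in
  let p := Num.sqrt (\tr ((A - q%:M) ^+ 2) / 6) in
  [/\ q = (A 0 0 + A 1 1 + A 2 2) / 3,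
      0 <= \tr ((A - q%:M) ^+ 2) / 6,
      p = Num.sqrt (((A 0 0 - q) ^+ 2 + (A 1 1 - q) ^+ 2 + (A 2 2 - q) ^+ 2
                     + 2 * A 0 1 ^+ 2 + 2 * A 0 2 ^+ 2 + 2 * A 1 2 ^+ 2) / 6),
      (p = 0 ->
         A = diag_mx (const_mx q) /\ eigenvalues_with_mult A [:: q; q; q]) &
      (p <> 0 ->
         let B := p^-1 *: (A - q%:M) in
         let theta3 := acos (\det B / 2) / 3 in
         let theta2 := 2 * pi / 3 - theta3 in
         let theta1 := 2 * pi / 3 + theta3 in
         let alpha1 := 2 * p * cos theta1 + q in
         let alpha2 := 2 * p * cos theta2 + q in
         let alpha3 := 2 * p * cos theta3 + q in
         [/\ `|\det B| <= 2,
             alpha1 <= alpha2,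
             alpha2 <= alpha3 &
             eigenvalues_with_mult A [:: alpha1; alpha2; alpha3]])].
Proof.
move=> q p.
set S := A - q%:M.
have symS : S^T = S by rewrite /S linearB /= tr_scalar_mx hA.
have trS0 : \tr S = 0.
  by rewrite linearB /= mxtrace_scalar -mulr_natr divfK ?subrr ?pnatr_eq0.
have trS2_ge0 : 0 <= \tr (S ^+ 2) / 6.
  by rewrite divr_ge0 // expr2 -mulmxE trace_sqr_sym_ge0.
have p2 : p ^+ 2 = \tr (S *m S) / 6 by rewrite sqr_sqrtr // expr2 mulmxE.
split=> //.
- by rewrite /q mxtrace3.
- congr (Num.sqrt (_ / 6)); rewrite expr2 -mulmxE trace_sqr_sym //.
  have symA i j : A j i = A i j by rewrite -[in LHS]hA mxE.
  rewrite !sum_ord3 /S !mxE /= (symA 0 1) (symA 0 2) (symA 1 2).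
  by rewrite !mulr1n !mulr0n; ring.
- move=> p0.
  have S0 : S = 0.
    by apply: trace_sqr_sym_eq0 => //; move: p2; rewrite p0; lra.
  have eA : A = diag_mx (const_mx q).
    by rewrite diag_const_mx; apply/eqP; rewrite -subr_eq0 -/S S0.
  split=> //; rewrite /eigenvalues_with_mult eA.
  rewrite char_poly_trig ?diag_mx_is_trig //.
  by rewrite !big_ord_recl big_ord0 !big_cons big_nil !mxE !eqxx !mulr1n.
move=> /eqP p0 B theta3 theta2 theta1 alpha1 alpha2 alpha3.
have trB0 : \tr B = 0 by rewrite linearZ /= trS0 mulr0.
have trB2 : \tr (B *m B) = 6.
  rewrite -scalemxAl -scalemxAr !linearZ /= mulrA -invfM -expr2.
  have -> : \tr (S *m S) = 6 * p ^+ 2 by rewrite p2; field.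
  by field.
have detB : `|\det B| <= 2.
  by apply: normr_det_normalized_le2; rewrite // linearZ /= symS.
have acos_dom : -1 <= \det B / 2 <= 1.
  by move: detB; rewrite ler_norml => /andP[? ?]; apply/andP; split; lra.
have th3_ge0 : 0 <= theta3 by have := acos_ge0 acos_dom; rewrite /theta3; lra.
have th3_le : theta3 <= pi / 3.
  by have := acos_lepi acos_dom; rewrite /theta3; lra.
have cos3th3 : 2 * cos (theta3 *+ 3) = \det B.
  rewrite (_ : theta3 *+ 3 = acos (\det B / 2)); last by rewrite /theta3; lra.
  by rewrite acosK ?in_itv //=; lra.
have p_gt0 : 0 < p by rewrite lt_def p0 sqrtr_ge0.
have pi0 := pi_gt0 R.
have le_alpha (a b : R) : 0 <= b -> b <= a -> a <= pi ->
    2 * p * cos a + q <= 2 * p * cos b + q.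
  move=> b0 ba api; rewrite lerD2r ler_pM2l ?mulr_gt0 //.
  by rewrite leNgt ltr_cos ?in_itv /= -?leNgt //; apply/andP; split; lra.
split=> //.
- by apply: le_alpha; rewrite /theta1 /theta2; lra.
- by apply: le_alpha; rewrite /theta2; lra.
have eB : eigenvalues_with_mult B
    [:: 2 * cos theta1; 2 * cos theta2; 2 * cos theta3].
  rewrite /eigenvalues_with_mult !big_cons big_nil mulr1.
  by rewrite -cubic_cos_factor cos3th3 char_poly_normalized.
have -> : A = p *: B + q%:M by rewrite scalerA divff // scale1r subrK.
have := eigenvalues_affine q p0 eB.
by rewrite /= !mulrA ![p * 2]mulrC.
Qed.
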